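(* Let $n\ge2$, let $P$ be a positive regular polynomial $n$-tuple and let $m\in\mathbb N^n$. The multiplication $n$-tuple $\mathscr M_z$ on $\mathscr H^2_m(\triangle^n_P)$ is strongly circular.
   Context: $\mathbb N$ = positive integers, $\mathbb C_*=\mathbb C\setminus\{0\}$, $z\diamond w=(z_1w_1,\ldots,z_nw_n)$, and $\overline z$ is the entrywise conjugate. For $n\ge2$ let $\varphi(z)=\big(\frac{z_1}{z_2},\ldots,\frac{z_{n-1}}{z_n},z_n\big)$ for $z\in\mathbb C\times\mathbb C_*^{n-1}$. A polynomial $n$-tuple $P=(P_1,\ldots,P_n)$ in $\mathbb C[z_1,\ldots,z_n]$ is positive regular if for each $j$, $P_j$ has nonnegative coefficients and $P_j(z)=a_jz_j+\sum_{k=2}^{N_j}Q_{jk}(z)$ with $a_j>0$ and $Q_{jk}$ homogeneous of degree $k$. The $P$-triangle is $\triangle^n_P=\{z\in\mathbb C\times\mathbb C_*^{n-1}: P_j(\varphi(z)\diamond\overline{\varphi(z)})<1,\ j=1,\ldots,n\}$. For $m\in\mathbb N^n$, $\mathscr H^2_m(\triangle^n_P)$ is the reproducing kernel Hilbert space of holomorphic functions on $\triangle^n_P$ with kernel $$\mathscr K_{P,m}(z,w)=\prod_{j=2}^n\frac1{z_j\overline w_j}\prod_{j=1}^n\frac1{\big(1-P_j(\varphi(z)\diamond\overline{\varphi(w)})\big)^{m_j}}.$$ Each $z_j$ is a multiplier of this space; $\mathscr M_{z_j}$ is the bounded operator of multiplication by $z_j$, and $\mathscr M_z=(\mathscr M_{z_1},\ldots,\mathscr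 M_{z_n})$. A commuting $n$-tuple $T=(T_1,\ldots,T_n)$ on $H$ is circular if for every $\theta=(\theta_1,\ldots,\theta_n)\in\mathbb R^n$ there is a unitary operator $\varGamma_\theta$ on $H$ with $\varGamma_\theta^*T_j\varGamma_\theta=e^{i\theta_j}T_j$ for $j=1,\ldots,n$. It is strongly circular if, in addition, $\varGamma_\theta$ can be chosen to be a strongly continuous unitary representation of $\mathbb T^n$ ($\mathbb T$ the unit circle), in the sense that for every $h\in H$ the map $\theta\mapsto\varGamma_\theta h$ is continuous on $\mathbb R^n$. *)

(* Defs.v *)
From HB Require Import structures.
From mathcomp Require Import all_boot all_order all_algebra.
From mathcomp Require Import complex.
From mathcomp Require Import all_classical all_reals all_analysis.
(* The notations of mpoly clash with those of mathcomp-analysis. *)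
From mathcomp Require Import -(notations) mpoly.

Set Implicit Arguments.
Unset Strict Implicit.
Unset Printing Implicit Defensive.

Import Order.TTheory GRing.Theory Num.Theory.
Import numFieldNormedType.Exports.
Local Open Scope ring_scope.
Local Open Scope classical_set_scope.

(* The inner product is linear in its first argument. *)
Record hilbertSpace (R : realType) := HilbertSpace {
  hilbert_carrier :> completeNormedModType R[i] ;
  inner : {dot hilbert_carrier for Num.conj} ;
  inner_norm : forall x : hilbert_carrier, `|x| ^+ 2 = inner x x }.

Section Operators.
Variables (R : realType) (H : hilbertSpace R).

Definition bounded_operator (A : H -> H) : Prop :=
  linear A /\ exists M : R[i], forall x, `|A x| <= M * `|x|.

Definition is_adjoint (A B : H -> H) : Prop :=
  forall x y, inner H (A x) y = inner H x (B y).

(* [U] is unitary, with adjoint [Us]. *)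
Definition unitary_with_adjoint (U Us : H -> H) : Prop :=
  [/\ bounded_operator U, is_adjoint U Us, cancel U Us & cancel Us U].

Definition expi (t : R) : R[i] := (cos t +i* sin t)%C.

Variable n : nat.
Implicit Types T : 'I_n -> H -> H.

Definition commuting_tuple T : Prop :=
  (forall j, bounded_operator (T j)) /\
  (forall j k h, T j (T k h) = T k (T j h)).

Definition rotates T (theta : 'rV[R]_n) (U Us : H -> H) : Prop :=
  unitary_with_adjoint U Us /\
  forall j h, Us (T j (U h)) = expi (theta 0 j) *: T j h.

Definition circular T : Prop :=
  commuting_tuple T /\ forall theta, exists U Us, rotates T theta U Us.

(* A representation of the torus T^n is given by its pullback along
   theta |-> (e^{i theta_1}, ..., e^{i theta_n}); the third condition below
   says that it factors through the torus. *)
Definition strongly_circular T : Prop :=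
  circular T /\
  exists Gamma Gammas : 'rV[R]_n -> H -> H,
    [/\ forall theta, rotates T theta (Gamma theta) (Gammas theta),
        forall (theta eta : 'rV[R]_n) h,
          Gamma (theta + eta) h = Gamma theta (Gamma eta h),
        forall theta eta : 'rV[R]_n,
          (forall j, expi (theta 0 j) = expi (eta 0 j)) ->
          Gamma theta = Gamma eta
      & forall h, continuous (fun theta : 'rV[R]_n => Gamma theta h)].

End Operators.

Definition holomorphic_on (K : numFieldType) (n : nat) (D : set 'rV[K]_n)
    (f : 'rV[K]_n -> K^o) : Prop :=
  forall z, D z -> differentiable f z.

Section PTriangle.
Variables (R : realType) (n : nat).
Local Notation C := R[i].
Implicit Types (z w : 'rV[C]_n) (P : 'I_n -> mpoly n C) (m : 'I_n -> nat).

Definition conjv z : 'rV[C]_n := map_mx Num.conj z.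

Definition diamond z w : 'rV[C]_n := \row_j (z 0 j * w 0 j).

(* [insub j.+1] is [None] exactly when [j] is the last index. *)
Definition phi z : 'rV[C]_n :=
  \row_j (if (insub j.+1 : option 'I_n) is Some k then z 0 j / z 0 k
          else z 0 j).

Definition positive_regular P : Prop :=
  forall j : 'I_n,
    (forall mu : multinom n, 0 <= mcoeff mu (P j)) /\
    exists (a : C) (N : nat) (Q : nat -> mpoly n C),
      [/\ 0 < a,
          forall k, Q k \is ishomog1 k mdeg
        & P j = a *: mpolyX C (mnm1 j) + \sum_(2 <= k < N.+1) Q k].

(* The comparison with 1 in [C] means that the left-hand side is real and
   smaller than 1; indices start at 0, so that the coordinates required to be
   nonzero are all but the first. *)
Definition triangle P : set 'rV[C]_n :=
  [set z : 'rV[C]_n | (forall j : 'I_n, (0 < j)%N -> z 0 j != 0) /\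
     forall j : 'I_n, meval (diamond (phi z) (conjv (phi z)) 0) (P j) < 1].

Definition triangle_kernel P m z w : C :=
  (\prod_(j < n | (0 < j)%N) (z 0 j * (w 0 j)^*)^-1) *
  \prod_(j < n)
    ((1 - meval (diamond (phi z) (conjv (phi w)) 0) (P j)) ^+ m j)^-1.

(* [H] is the reproducing kernel Hilbert space of holomorphic functions on [D]
   with kernel [K]; [ev h] is the function on [D] represented by [h], and its
   values outside [D] are irrelevant. *)
Record holomorphic_RKHS (H : hilbertSpace R) (ev : H -> 'rV[C]_n -> C^o)
    (D : set 'rV[C]_n) (K : 'rV[C]_n -> 'rV[C]_n -> C) : Prop := {
  rkhs_linear : forall (a : C) (f g : H) z, D z ->
    ev (a *: f + g) z = a * ev f z + ev g z ;
  rkhs_ext : forall f g : H, (forall z, D z -> ev f z = ev g z) -> f = g ;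
  rkhs_holomorphic : forall f : H, holomorphic_on D (ev f) ;
  rkhs_kernel : forall w, D w -> exists kw : H,
    (forall z, D z -> ev kw z = K z w) /\
    (forall f : H, ev f w = inner H f kw) }.

Definition multiplication_tuple (H : hilbertSpace R)
    (ev : H -> 'rV[C]_n -> C^o) (D : set 'rV[C]_n) (M : 'I_n -> H -> H) : Prop :=
  forall j, bounded_operator (M j) /\
    forall f z, D z -> ev (M j f) z = z 0 j * ev f z.

End PTriangle.

(* Main.v *)
Require Import Defs.
From mathcomp Require Import all_boot all_order all_algebra.
From mathcomp Require Import complex.
From mathcomp Require Import all_classical all_reals all_analysis.
From mathcomp Require Import -(notations) mpoly.
From mathcomp Require Import ring lra.

(* Both the triangle and its kernel are invariant under the coordinatewise
   rotations, because [phi] turns a rotation into a rotation.  Hence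
   f |-> f o (rotation by -theta) is a unitary representation intertwining the
   multiplications by the coordinates.  Everything that has to be known for all
   f (that f o rotation lies in the space, that the representation is strongly
   continuous) holds on a closed subspace, so it is enough to check it on the
   kernel functions; for these, continuity at theta = 0 amounts to the
   continuity of the holomorphic function K(., w) at w. *)

Set Implicit Arguments.
Unset Strict Implicit.
Unset Printing Implicit Defensive.

Import Order.TTheory GRing.Theory Num.Theory.
Import numFieldNormedType.Exports.
Local Open Scope ring_scope.
Local Open Scope classical_set_scope.

Lemma ge0_complexE (R : rcfType) (a : R[i]) : 0 <= a -> a = (complex.Re a)%:C%C.
Proof. by case: a => a b; rewrite lecE /= => /andP[/eqP ->]. Qed.

(** * Hilbert space geometry: Cauchy-Schwarz, nearest points, orthogonality, limits *)

Section HilbertSpace.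
Variables (R : realType) (H : hilbertSpace R).
Implicit Types (x y z : H) (a : R[i]).

Lemma innerC x y : inner H x y = (inner H y x)^*.
Proof. by rewrite hermC expr0 mul1r. Qed.

Lemma innerZr a x y : inner H x (a *: y) = a^* * inner H x y.
Proof. by rewrite linearZr_LR. Qed.

(** Pythagoras for the projection onto the line of [y]. It yields both Cauchy-Schwarz and the
    orthogonality of the nearest-point residual. *)
Lemma inner_sub_projection x y : y != 0 ->
  `|x - (inner H x y / inner H y y) *: y| ^+ 2 =
    inner H x x - `|inner H x y| ^+ 2 / inner H y y.
Proof.
move=> y0; have yy0 : inner H y y != 0 by rewrite dnorm_eq0.
have qC : (inner H x y / inner H y y)^* = inner H y x / inner H y y.
  by rewrite rmorphM /= fmorphV /= -!innerC.
rewrite inner_norm dnormB dnormZ innerZr !normCK qC !rmorphM /= fmorphV /= -!innerC.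
by field.
Qed.

Lemma norm_inner_le x y : `|inner H x y| <= `|x| * `|y|.
Proof.
have [->|y0] := eqVneq y 0; first by rewrite linear0r !normr0 mulr0.
rewrite -(@ler_pXn2r _ 2) ?nnegrE ?mulr_ge0 // exprMn !inner_norm.
have yy0 : 0 < inner H y y by rewrite dnorm_gt0.
by rewrite -ler_pdivrMr // -subr_ge0 -inner_sub_projection // exprn_ge0.
Qed.

(** The norm takes values in [R[i]]; its real-valued copy lives in an ordered field with infima. *)
Definition rnorm x : R := complex.Re `|x|.

Lemma rnormE x : `|x| = (rnorm x)%:C%C.
Proof. exact/ge0_complexE/normr_ge0. Qed.

Lemma rnorm_ge0 x : 0 <= rnorm x.
Proof. by rewrite -lecR -rnormE; exact: normr_ge0. Qed.

Lemma rnormD x y : rnorm (x + y) <= rnorm x + rnorm y.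
Proof. by rewrite -lecR rmorphD /= -!rnormE ler_normD. Qed.

Lemma rnormBC x y : rnorm (x - y) = rnorm (y - x).
Proof. by rewrite /rnorm distrC. Qed.

Lemma rnorm_dist x y z : rnorm (x - z) <= rnorm (x - y) + rnorm (y - z).
Proof. by apply: le_trans (rnormD _ _); rewrite addrA subrK. Qed.

Lemma rnorm_parallelogram x y :
  rnorm (x + y) ^+ 2 + rnorm (x - y) ^+ 2 = 2 * rnorm x ^+ 2 + 2 * rnorm y ^+ 2.
Proof.
apply: (@complexI R); rewrite !(rmorphD, rmorphM, rmorphXn) /= -!rnormE.
rewrite -!expr2 !inner_norm dnormB dnormD; ring.
Qed.

Definition closed_subspace (S : set H) : Prop :=
  [/\ S 0, forall a x y, S x -> S y -> S (a *: x + y) & closed S].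

Lemma closure_rnorm (S : set H) x :
  closure S x <-> forall e : R, 0 < e -> exists2 s, S s & rnorm (x - s) < e.
Proof.
split=> [clSx e e0|Sx B].
  have [|s [Ss]] := clSx (ball x e%:C%C); first by apply: nbhsx_ballx; rewrite ltcR.
  by rewrite -ball_normE /= rnormE ltcR; exists s.
rewrite -nbhs_ballE => -[e /= e0 eB].
have eE := ge0_complexE (ltW e0).
have [|s Ss xs] := Sx (complex.Re e); first by rewrite -ltcR -eE.
by exists s; split=> //; apply: eB; rewrite -ball_normE /= eE rnormE ltcR.
Qed.

(* Completeness, for the filter generated by the sets [A d]. *)
Lemma nested_cauchy_limit (A : R -> set H) :
  (forall d, 0 < d -> A d !=set0) ->
  (forall d d', d <= d' -> A d `<=` A d') ->
  (forall e, 0 < e -> exists2 d, 0 < d &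
     forall x y, A d x -> A d y -> rnorm (x - y) < e) ->
  exists p, forall d, 0 < d -> closure (A d) p.
Proof.
move=> A0 Amono Acauchy.
pose F := filter_from [set d : R | 0 < d] A.
have FF : ProperFilter F.
  apply: filter_from_proper => //; apply: filter_from_filter.
    by exists 1 => /=; exact: ltr01.
  move=> d d' /= d0 d'0; exists (Num.min d d'); first by rewrite /= lt_min d0.
  by move=> x Ax; split; apply: Amono Ax; rewrite ge_min lexx ?orbT.
have /cauchy_cvg cvF : cauchy F.
  apply/cauchyP => e e0.
  have eE := ge0_complexE (ltW e0).
  have [|d d0 Ad] := Acauchy (complex.Re e); first by rewrite -ltcR -eE.
  have [x Ax] := A0 _ d0; exists x; exists d => // y Ay.
  by rewrite -ball_normE /= eE rnormE ltcR Ad.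
exists (lim F) => d d0 B /cvF [d' d'0 A'B].
have [|x Ax] := A0 (Num.min d d'); first by rewrite lt_min d0.
exists x; split; first by apply: Amono Ax; rewrite ge_min lexx.
by apply: A'B; apply: Amono Ax; rewrite ge_min lexx orbT.
Qed.

(** The almost-minimizers form nested sets. The midpoint of two of them lies in [S], so the
    parallelogram law bounds their distance, and completeness gives the limit. *)
Lemma nearest_point (S : set H) x : closed_subspace S ->
  exists2 p, S p & forall s, S s -> rnorm (x - p) <= rnorm (x - s).
Proof.
move=> [S0 Slin Scl]; pose E := [set rnorm (x - s) | s in S].
have E0 : has_inf E.
  split; first by exists (rnorm (x - 0)), 0.
  by exists 0 => _ [s _ <-]; exact: rnorm_ge0.
have infE s : S s -> inf E <= rnorm (x - s).
  by move=> Ss; apply: ge_inf; [exact: E0.2|exists s].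
have inf0 : 0 <= inf E by apply: lb_le_inf; [exact: E0.1|move=> _ [s _ <-]; exact: rnorm_ge0].
pose A d := [set s | S s /\ rnorm (x - s) < inf E + d].
have [||e e0|p Ap] := @nested_cauchy_limit A.
- by move=> d d0; have [_ [s Ss <-] sd] := inf_adherent d0 E0; exists s.
- by move=> d d' dd' s [Ss sd]; split=> //; lra.
(* The parallelogram law gives [rnorm (s - t) ^+ 2 <= 4 (inf E + d)^2 - 4 (inf E)^2 = 8 d inf E + 4
   d^2], at most [d (8 inf E + 4)] as [d <= 1]; 5 in place of 4 makes the bound strict. *)
- pose d := Num.min 1 (e ^+ 2 / (8 * inf E + 5)).
  have den0 : 0 < 8 * inf E + 5 by lra.
  have d0 : 0 < d by rewrite lt_min ltr01 divr_gt0 // exprn_gt0.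
  have d1 : d <= 1 by rewrite ge_min lexx.
  have de : d * (8 * inf E + 5) <= e ^+ 2.
    by rewrite -ler_pdivlMr // ge_min lexx orbT.
  exists d => // s t [Ss xs] [St xt].
  have Sm : S (2^-1 *: s + 2^-1 *: t).
    by apply: (Slin) => //; rewrite -[_ *: t]addr0; exact: Slin.
  have := rnorm_parallelogram (x - s) (x - t).
  have -> : x - s - (x - t) = t - s by rewrite opprB addrC subrKA.
  have -> : x - s + (x - t) = 2 *: (x - (2^-1 *: s + 2^-1 *: t)).
    rewrite scalerBr scalerDr !scalerA mulfV ?pnatr_eq0 // !scale1r scaler_nat.
    by rewrite mulr2n opprD addrACA.
  have -> : rnorm (2 *: (x - (2^-1 *: s + 2^-1 *: t)))
      = 2 * rnorm (x - (2^-1 *: s + 2^-1 *: t)).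
    apply: (@complexI R); rewrite rmorphM /= -!rnormE normrZ normr_nat.
    by rewrite rmorphMn rmorph1.
  rewrite (rnormBC t).
  have := infE _ Sm; have := rnorm_ge0 (x - s); have := rnorm_ge0 (x - t).
  have := rnorm_ge0 (s - t).
  move: (rnorm (x - (_ + _))) (rnorm (x - s)) (rnorm (x - t)) (rnorm (s - t)) xs xt =>
    c u v w ud vd w0 v0 u0 ic eq.
  have uu : u ^+ 2 <= (inf E + d) ^+ 2 by rewrite ler_pXn2r ?nnegrE //; lra.
  have vv : v ^+ 2 <= (inf E + d) ^+ 2 by rewrite ler_pXn2r ?nnegrE //; lra.
  have cc : inf E ^+ 2 <= c ^+ 2 by rewrite ler_pXn2r ?nnegrE //; lra.
  rewrite -(@ltr_pXn2r _ 2) ?nnegrE ?(ltW e0) //.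
  have dd : d * d <= d by rewrite ger_pMr.
  nra.
have Sp : S p.
  apply: Scl; have := Ap 1 ltr01; apply: closure_subset => s []//.
exists p => // s Ss; apply/ler_addgt0Pr => e e0.
have e20 : 0 < e / 2 by lra.
have /closure_rnorm/(_ _ e20)[t [St xt] pt] := Ap _ e20.
have := rnorm_dist x t p; have := infE _ Ss; rewrite (rnormBC t); lra.
Qed.

(** The difference between [x] and its nearest point in [S] is orthogonal to [S], hence zero. *)
Lemma closed_subspace_setT (S : set H) : closed_subspace S ->
  (forall x, (forall s, S s -> inner H x s = 0) -> x = 0) -> forall x, S x.
Proof.
move=> Sclosed Sorth x; have [S0 Slin Scl] := Sclosed.
have [p Sp pmin] := nearest_point x Sclosed.
suff /Sorth/eqP : forall s, S s -> inner H (x - p) s = 0 by rewrite subr_eq0 => /eqP ->.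
move=> s Ss; have [->|s0] := eqVneq s 0; first by rewrite linear0r.
have ss0 : 0 < inner H s s by rewrite dnorm_gt0.
set c := inner H (x - p) s / inner H s s.
(* [p + c *: s] is a competitor in [S], yet subtracting [c *: s] lowers the squared norm by
   [|inner H (x - p) s|^2 / inner H s s]; minimality forces this to vanish. *)
have : rnorm (x - p) <= rnorm (x - p - c *: s).
  by rewrite -addrA -opprD [p + _]addrC; apply: pmin; exact: Slin.
rewrite -lecR -!rnormE -(@ler_pXn2r _ 2) ?nnegrE // inner_sub_projection //.
rewrite inner_norm lerBrDl gerDr pmulr_lle0 ?invr_gt0 // => le0.
apply/eqP; rewrite -normr_eq0 -sqrf_eq0 eq_le le0 exprn_ge0 //.
Qed.

(** Continuity of the inner product, by Cauchy-Schwarz. The approximants come in pairs because the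
    identity is known only for matching [x'] and [y']. *)
Lemma inner_limit (x y u v : H) :
  (forall e : R, 0 < e -> exists x' y', [/\ rnorm (x - x') < e,
     rnorm (y - y') < e & inner H x' u = inner H y' v]) ->
  inner H x u = inner H y v.
Proof.
move=> lim; apply/eqP; rewrite -subr_eq0 -normr_le0.
apply/ler_addgt0Pr => e e0; rewrite add0r.
have eE := ge0_complexE (ltW e0).
have re0 : 0 < complex.Re e by rewrite -ltcR -eE.
have u0 := rnorm_ge0 u; have v0 := rnorm_ge0 v.
have den0 : 0 < rnorm u + rnorm v + 1 by lra.
have [|x' [y' [xx' yy' E]]] := lim (complex.Re e / (rnorm u + rnorm v + 1)).
  exact: divr_gt0.
have -> : inner H x u - inner H y v = inner H (x - x') u - inner H (y - y') v.
  by rewrite !linearBl /= E; ring.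
apply: (le_trans (ler_normB _ _)).
apply: (le_trans (lerD (norm_inner_le _ _) (norm_inner_le _ _))).
rewrite eE !rnormE -!rmorphM -rmorphD lecR.
move: xx' yy'; rewrite !ltr_pdivlMr //.
have := rnorm_ge0 (x - x'); have := rnorm_ge0 (y - y').
nra.
Qed.

End HilbertSpace.

(** * Reproducing kernels and isometric composition operators *)

Section ReproducingKernel.
Variables (R : realType) (n : nat) (H : hilbertSpace R).
Variables (ev : H -> 'rV[R[i]]_n -> (R[i])^o) (D : set 'rV[R[i]]_n).
Variable K : 'rV[R[i]]_n -> 'rV[R[i]]_n -> R[i].
Hypothesis hH : holomorphic_RKHS ev D K.

Definition kernel_at (w : 'rV[R[i]]_n) (k : H) : Prop :=
  (forall z, D z -> ev k z = K z w) /\ (forall f : H, ev f w = inner H f k).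

Lemma ev0 z : D z -> ev 0 z = 0.
Proof. by move=> /(rkhs_kernel hH)[k [_ evk]]; rewrite evk linear0l. Qed.

(** A vector orthogonal to [S] is orthogonal to every kernel function, so the function it represents
    vanishes on [D]. *)
Lemma closed_subspace_kernels (S : set H) : closed_subspace S ->
  (forall w k, D w -> kernel_at w k -> S k) -> forall f, S f.
Proof.
move=> Sclosed Sk; apply: closed_subspace_setT => // x xS.
apply: (rkhs_ext hH) => z Dz; rewrite ev0 //.
by have [k kz] := rkhs_kernel hH Dz; rewrite kz.2 xS //; exact: Sk kz.
Qed.

Section Composition.
Variables rho rho' : 'rV[R[i]]_n -> 'rV[R[i]]_n.
Hypothesis rhoD : forall z, D z -> D (rho z).
Hypothesis rho'D : forall z, D z -> D (rho' z).
Hypothesis rho'K : forall z, D z -> rho (rho' z) = z.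
Hypothesis Krho : forall z w, D z -> D w -> K (rho z) (rho w) = K z w.

Definition represents_comp (f g : H) : Prop := forall z, D z -> ev g z = ev f (rho z).

(* Testing against all pairs [f', g'], rather than asking that [f] and [g] have
   the same norm, is what makes this condition linear in [f]. *)
Let isometric_comp : set H := [set f | exists2 g, represents_comp f g &
  forall f' g', represents_comp f' g' -> inner H g g' = inner H f f'].

(** For closedness, take approximants of [f]: their compositions with [rho] are as close to each
    other as the approximants are, so they converge, and the limit represents the composition of
    [f]. *)
Let isometric_comp_closed_subspace : closed_subspace isometric_comp.
Proof.
have lin a f f' z := rkhs_linear hH a f f' (z := z).
have compP a f g f' g' : represents_comp f g -> represents_comp f' g' ->
    represents_comp (a *: f + f') (a *: g + g').
  by move=> fg f'g' z Dz; rewrite !lin ?fg ?f'g' //; exact: rhoD.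
split.
- exists 0 => [z Dz|f' g' _]; last by rewrite !linear0l.
  by rewrite !ev0 //; exact: rhoD.
- move=> a f f' [g fg gi] [g' f'g' g'i]; exists (a *: g + g'); first exact: compP.
  by move=> h h' hh'; rewrite !linearPl /= (gi _ _ hh') (g'i _ _ hh').
- move=> f /closure_rnorm cf.
  pose A d := [set g | exists f', [/\ rnorm (f - f') < d, represents_comp f' g &
    forall h h', represents_comp h h' -> inner H g h' = inner H f' h]].
  have [d d0|d d' dd' g [f' [ff' f'g gi]]|e e0|g Ag] := @nested_cauchy_limit R H A.
  + by have [f' [g f'g gi] ff'] := cf d d0; exists g, f'.
  + by exists f'; split=> //; exact: lt_le_trans dd'.
  + exists (e / 2) => [|g g' [f1 [ff1 f1g gi]] [f2 [ff2 f2g g'i]]]; first by lra.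
    have f12 : represents_comp (f1 - f2) (g - g').
      by have := compP (-1) _ _ _ _ f2g f1g; rewrite !scaleN1r ![- _ + _]addrC.
    have -> : rnorm (g - g') = rnorm (f1 - f2).
      apply: (@complexI R); rewrite -!rnormE; apply/eqP.
      rewrite -(@eqrXn2 _ 2) // !inner_norm linearBl /= (gi _ _ f12) (g'i _ _ f12).
      by rewrite -linearBl.
    have := rnorm_dist f1 f f2; rewrite (rnormBC f1 f); lra.
  (* Identities between inner products of matched pairs pass to the limit pair [f], [g]. This serves
     twice: for point values, which are inner products with kernel functions, and for the isometry
     condition. *)
  + have lim u v : (forall f' g', represents_comp f' g' ->
         (forall h h', represents_comp h h' -> inner H g' h' = inner H f' h) ->
         inner H g' u = inner H f' v) -> inner H g u = inner H f v.
      move=> uv; apply: inner_limit => e e0.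
      have /closure_rnorm/(_ _ e0)[g' [f' [ff' f'g' g'i]] gg'] := Ag _ e0.
      by exists g', f'; split=> //; exact: uv.
    exists g => [z Dz|f' g' f'g']; last by apply: lim => h h' _; exact.
    have [kz [_ evz]] := rkhs_kernel hH Dz.
    have [krz [_ evrz]] := rkhs_kernel hH (rhoD Dz).
    by rewrite evz evrz; apply: lim => h h' hh' _; rewrite -evz -evrz hh'.
Qed.

(** The kernel function at [w] composed with [rho] is the kernel function at [rho' w], since [K (rho
    z) w = K (rho z) (rho (rho' w)) = K z (rho' w)]. *)
Lemma comp_isometric f : isometric_comp f.
Proof.
apply: closed_subspace_kernels => // w k Dw [kK kev].
have [k' [k'K k'ev]] := rkhs_kernel hH (rho'D Dw).
exists k' => [z Dz|f' g' f'g'].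
  rewrite k'K // kK; last exact: rhoD.
  by rewrite -(Krho Dz (rho'D Dw)) rho'K.
by rewrite innerC -k'ev (f'g' _ (rho'D Dw)) rho'K // kev -innerC.
Qed.

Lemma comp_isometry : exists U : H -> H,
  (forall f, represents_comp f (U f)) /\ (forall f g, inner H (U f) (U g) = inner H f g).
Proof.
have /choice[U UP] f : exists g, represents_comp f g /\
    forall f' g', represents_comp f' g' -> inner H g g' = inner H f f'.
  by have [g] := comp_isometric f; exists g.
exists U; split=> [f|f g]; first exact: (UP f).1.
exact: (UP f).2 (UP g).1.
Qed.

End Composition.
End ReproducingKernel.

(** * Coordinatewise rotations and the invariance of the triangle and its kernel *)

Section Rotation.
Variables (R : realType) (n : nat).
Implicit Types (theta eta : 'rV[R]_n) (z w : 'rV[R[i]]_n).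

Lemma expi0 : expi (0 : R) = 1.
Proof. by rewrite /expi cos0 sin0. Qed.

Lemma expiD (s t : R) : expi (s + t) = expi s * expi t.
Proof.
by apply/eqP; rewrite eq_complex /= cosD sinD; apply/andP; split; apply/eqP; ring.
Qed.

Lemma expiN (t : R) : expi (- t) = (expi t)^*.
Proof. by rewrite /expi cosN sinN. Qed.

Lemma expi_conjM (t : R) : expi t * (expi t)^* = 1.
Proof. by rewrite -expiN -expiD subrr expi0. Qed.

Lemma expi_neq0 (t : R) : expi t != 0.
Proof.
by apply/eqP => e0; have /eqP := expi_conjM t; rewrite e0 mul0r eq_sym oner_eq0.
Qed.

Lemma expi_inv (t : R) : (expi t)^-1 = (expi t)^*.
Proof. by rewrite -[LHS]mulr1 -(expi_conjM t) mulKf ?expi_neq0. Qed.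

Definition rotate theta z : 'rV[R[i]]_n := diamond (\row_j expi (theta 0 j)) z.

Lemma rotateE theta z j : rotate theta z 0 j = expi (theta 0 j) * z 0 j.
Proof. by rewrite !mxE. Qed.

Lemma rotate0 z : rotate 0 z = z.
Proof. by apply/rowP => j; rewrite rotateE mxE expi0 mul1r. Qed.

Lemma rotateD theta eta z : rotate (theta + eta) z = rotate theta (rotate eta z).
Proof. by apply/rowP => j; rewrite !rotateE mxE expiD mulrA. Qed.

Lemma expi_mul_conj (t : R) (a b : R[i]) :
  (expi t * a) * (expi t * b)^* = a * b^*.
Proof. by rewrite rmorphM /= mulrACA expi_conjM mul1r. Qed.

Lemma phi_rotate theta z :
  phi (rotate theta z) =
  rotate (\row_j (if (insub j.+1 : option 'I_n) is Some k
                  then theta 0 j - theta 0 k else theta 0 j)) (phi z).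
Proof.
apply/rowP => j; rewrite rotateE !mxE; case: insub => [k|//].
by rewrite rotateE invfM mulrACA expiD expiN expi_inv.
Qed.

(** Each phase cancels against its conjugate. The [P j] enter the triangle and the kernel only
    through such products. *)
Lemma diamond_rotate theta z w :
  diamond (rotate theta z) (conjv (rotate theta w)) = diamond z (conjv w).
Proof. by apply/rowP => j; rewrite !mxE expi_mul_conj. Qed.

Lemma diamond_phi_rotate theta z w :
  diamond (phi (rotate theta z)) (conjv (phi (rotate theta w))) =
  diamond (phi z) (conjv (phi w)).
Proof. by rewrite !phi_rotate diamond_rotate. Qed.

Lemma triangle_rotate P theta z : triangle P z -> triangle P (rotate theta z).
Proof.
move=> [z0 zP]; split=> j; last by rewrite diamond_phi_rotate.
by move=> j0; rewrite rotateE mulf_neq0 ?expi_neq0 ?z0.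
Qed.

Lemma triangle_kernel_rotate P m theta z w :
  triangle_kernel P m (rotate theta z) (rotate theta w) = triangle_kernel P m z w.
Proof.
rewrite /triangle_kernel diamond_phi_rotate; congr (_ * _).
by apply: eq_bigr => j _; rewrite !rotateE expi_mul_conj.
Qed.

Lemma expi_near1 (e : R[i]) : 0 < e -> \forall t \near (0 : R), `|expi t - 1| < e.
Proof.
move=> e0; have eE := ge0_complexE (ltW e0).
move: e0; rewrite [in X in X -> _]eE ltcR => e0.
have e20 : 0 < complex.Re e / 2 by lra.
have cosC := @continuous_cos R 0; have sinC := @continuous_sin R 0.
have /cvgrPdist_lt/(_ _ e20) c0 := cosC; have /cvgrPdist_lt/(_ _ e20) s0 := sinC.
near=> t.
have ct : `|cos 0 - cos t| < complex.Re e / 2 by near: t.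
have st : `|sin 0 - sin t| < complex.Re e / 2 by near: t.
have -> : expi t - 1 = (cos t - 1)%:C%C + 'i%C * (sin t)%:C%C.
  by apply/eqP; rewrite eq_complex /=; apply/andP; split; apply/eqP; ring.
apply: le_lt_trans (ler_normD _ _) _; rewrite normrM.
have -> : `|'i%C : R[i]| = 1 by rewrite normc_def /= expr0n expr1n add0r sqrtr1.
have normR (x : R) : `|x%:C%C| = `|x|%:C%C.
  by rewrite normc_def /= expr0n addr0 sqrtr_sqr.
rewrite eE mul1r !normR -rmorphD ltcR.
move: ct st; rewrite cos0 sin0 sub0r normrN distrC; lra.
Unshelve. all: by end_near.
Qed.

(** The [let] views [R[i]] as a [numFieldType], the setting of [holomorphic_on], so that the limit
    composes with holomorphic functions. *)
Lemma rotate_cvg z : let K : numFieldType := R[i] in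
  (rotate theta z : 'rV[K]_n) @[theta --> (0 : 'rV[R]_n)] --> (z : 'rV[K]_n).
Proof.
move=> K; apply/(@cvg_ballP _ _ _ (nbhs (0 : 'rV[R]_n)) (nbhs_filter _)) => e e0.
suff /(filter_forall (nbhs_filter _)) near_z : forall j : 'I_n,
    \forall theta \near (0 : 'rV[R]_n), `|z 0 j - rotate theta z 0 j| < e.
  by apply: filterS near_z => theta ze; split=> // i j; rewrite ord1 -ball_normE; exact: ze.
(* The added 1 keeps the denominator positive when the coordinate is zero. *)
move=> j; have den0 : 0 < `|z 0 j| + 1 by rewrite ltr_wpDl.
have d0 : 0 < e / (`|z 0 j| + 1) by exact: divr_gt0.
have cj : (fun theta : 'rV[R]_n => theta 0 j) @ (0 : 'rV[R]_n) --> (0 : R).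
  have := @coord_continuous R 1 n 0 j (0 : 'rV[R]_n).
  by rewrite /continuous_at mxE.
have near_d : \forall theta \near (0 : 'rV[R]_n),
    `|expi ((theta : 'rV[R]_n) 0 j) - 1| < e / (`|z 0 j| + 1).
  exact: cj (expi_near1 d0).
apply: filterS near_d => theta.
rewrite /= rotateE ltr_pdivlMr // distrC -{2}[z 0 j]mul1r -mulrBl normrM.
by apply: le_lt_trans; rewrite ler_wpM2l // lerDl.
Qed.

End Rotation.

(** * The unitary representation attached to a rotation-invariant kernel *)

Section RotationInvariantKernel.
Variables (R : realType) (n : nat) (H : hilbertSpace R).
Variables (ev : H -> 'rV[R[i]]_n -> (R[i])^o) (D : set 'rV[R[i]]_n).
Variable K : 'rV[R[i]]_n -> 'rV[R[i]]_n -> R[i].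
Hypothesis hH : holomorphic_RKHS ev D K.
Hypothesis Drot : forall (theta : 'rV[R]_n) z, D z -> D (rotate theta z).
Hypothesis Krot : forall (theta : 'rV[R]_n) z w,
  K (rotate theta z) (rotate theta w) = K z w.
Implicit Types (theta eta : 'rV[R]_n).

(** The sign in [rotate (- theta)] is what makes conjugation by [U theta] produce the factor
    [expi (theta 0 j)] and not its conjugate. *)
Lemma rotation_isometries : exists U : 'rV[R]_n -> H -> H,
  (forall theta f, represents_comp ev D (rotate (- theta)) f (U theta f)) /\
  (forall theta f g, inner H (U theta f) (U theta g) = inner H f g).
Proof.
have /choice[U UP] theta : exists V : H -> H,
    (forall f, represents_comp ev D (rotate (- theta)) f (V f)) /\
    (forall f g, inner H (V f) (V g) = inner H f g).
  apply: (comp_isometry hH (rho' := rotate theta)) => [z|z|z _|z w _ _].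
  - exact: Drot.
  - exact: Drot.
  - by rewrite -rotateD addNr rotate0.
  - exact: Krot.
by exists U; split=> theta; [exact: (UP theta).1|exact: (UP theta).2].
Qed.

Section RotationGroup.
Variable U : 'rV[R]_n -> H -> H.
Hypothesis evU : forall theta f, represents_comp ev D (rotate (- theta)) f (U theta f).
Hypothesis innerU : forall theta f g, inner H (U theta f) (U theta g) = inner H f g.

Lemma rotation_linear theta : linear (U theta).
Proof.
move=> a f g; apply: (rkhs_ext hH) => z Dz.
have Dz' : D (rotate (- theta) z) by exact: Drot.
by rewrite (rkhs_linear hH) // !(evU _ _ Dz) (rkhs_linear hH).
Qed.

Lemma rotationB theta f g : U theta (f - g) = U theta f - U theta g.
Proof. by rewrite -scaleN1r addrC rotation_linear scaleN1r addrC. Qed.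

Lemma rotationD theta eta f : U (theta + eta) f = U theta (U eta f).
Proof.
apply: (rkhs_ext hH) => z Dz; have Dz' : D (rotate (- theta) z) by exact: Drot.
by rewrite (evU _ _ Dz) (evU _ _ Dz) (evU _ _ Dz') -rotateD opprD addrC.
Qed.

Lemma rotation0 f : U 0 f = f.
Proof. by apply: (rkhs_ext hH) => z Dz; rewrite (evU _ _ Dz) oppr0 rotate0. Qed.

Lemma rotationK theta : cancel (U theta) (U (- theta)).
Proof. by move=> f; rewrite -rotationD addNr rotation0. Qed.

Lemma rotationNK theta : cancel (U (- theta)) (U theta).
Proof. by move=> f; rewrite -rotationD subrr rotation0. Qed.

Lemma rnorm_rotation theta f : rnorm (U theta f) = rnorm f.
Proof.
apply: (@complexI R); rewrite -!rnormE; apply/eqP.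
by rewrite -(@eqrXn2 _ 2) // !inner_norm innerU.
Qed.

Lemma rotation_unitary theta : unitary_with_adjoint (U theta) (U (- theta)).
Proof.
split; [split| | |].
- exact: rotation_linear.
- by exists 1 => f; rewrite !rnormE rnorm_rotation mul1r.
- by move=> f g; rewrite -(innerU (- theta)) rotationK.
- exact: rotationK.
- exact: rotationNK.
Qed.

Lemma rotation_torus theta eta :
  (forall j, expi (theta 0 j) = expi (eta 0 j)) -> U theta = U eta.
Proof.
move=> te; apply: funext => f; apply: (rkhs_ext hH) => z Dz; rewrite !(evU _ _ Dz).
by congr (ev f); apply/rowP => j; rewrite !rotateE !mxE !expiN te.
Qed.

(** The outer rotation moves the evaluation to [rotate theta z], where [M] contributes the rotated
    coordinate; the inner rotation then brings the argument of [f] back to [z]. *)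
Lemma rotation_mul theta j (M : H -> H) :
  (forall f z, D z -> ev (M f) z = z 0 j * ev f z) ->
  forall f, U (- theta) (M (U theta f)) = expi (theta 0 j) *: M f.
Proof.
move=> evM f; apply: (rkhs_ext hH) => z Dz.
have Dz' : D (rotate (- - theta) z) by exact: Drot.
rewrite (evU _ _ Dz) evM // (evU _ _ Dz') -rotateD addrC opprK subrr rotate0.
by rewrite -[_ *: M f]addr0 (rkhs_linear hH) // (ev0 hH Dz) addr0 evM // rotateE mulrA.
Qed.

(* Reduces continuity at [eta] to [0]: [U] is a group of isometries. *)
Lemma rnorm_rotationB theta eta f :
  rnorm (U eta f - U theta f) = rnorm (f - U (theta - eta) f).
Proof.
rewrite -(rnorm_rotation (- eta) (U eta f - _)) rotationB rotationK -rotationD.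
by rewrite [- eta + _]addrC.
Qed.

(** Since [U theta] is isometric and [k] reproduces values at [w], the squared norm is twice the
    real part of [ev k w - ev k (rotate (- theta) w)], which tends to 0 because [ev k] is continuous
    at [w]. *)
Lemma rotation_cvg0_kernel w k : D w -> kernel_at ev D K w k ->
  forall e : R, 0 < e -> \forall theta \near (0 : 'rV[R]_n), rnorm (k - U theta k) < e.
Proof.
move=> Dw [_ kev] e e0; pose C : numFieldType := R[i].
have evk_cvg : (ev k : 'rV[C]_n -> C^o) @ (w : 'rV[C]_n) --> (ev k w : C^o).
  exact/differentiable_continuous/(rkhs_holomorphic hH).
have oppr_cvg : (fun theta => - theta) @ (0 : 'rV[R]_n) --> (0 : 'rV[R]_n).
  have := @cvgN R 'rV[R]_n _ _ (nbhs_filter _) id 0 cvg_id.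
  by rewrite oppr0.
(* Half of [e ^+ 2], as the squared norm is a number plus its conjugate. *)
have d0 : 0 < (e ^+ 2 / 2)%:C%C :> C by rewrite ltcR divr_gt0 // exprn_gt0.
have near_w := cvg_comp _ _ oppr_cvg (cvg_comp _ _ (@rotate_cvg R n w) evk_cvg).
have /cvgrPdist_lt/(_ _ d0) := near_w.
apply: filterS => theta /= wU.
have normE : `|k - U theta k| ^+ 2 =
    (ev k w - ev k (rotate (- theta) w)) + (ev k w - ev k (rotate (- theta) w))^*.
  rewrite inner_norm dnormB innerU -(evU _ _ Dw) !kev rmorphB /= -!innerC.
  by ring.
rewrite -(@ltr_pXn2r _ 2) ?nnegrE ?rnorm_ge0 ?ltW // -ltcR rmorphXn /= -rnormE.
rewrite -[X in X < _]ger0_norm ?exprn_ge0 // normE.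
apply: le_lt_trans (ler_normD _ _) _; rewrite norm_conjC [e ^+ 2]splitr rmorphD.
exact: ltrD.
Qed.

Lemma rotation_cvg0 f (e : R) : 0 < e ->
  \forall theta \near (0 : 'rV[R]_n), rnorm (f - U theta f) < e.
Proof.
move: f e; pose S := [set f : H | forall e : R, 0 < e ->
  \forall theta \near (0 : 'rV[R]_n), rnorm (f - U theta f) < e].
suff SH : forall f, S f by [].
apply: (closed_subspace_kernels hH) => [|w k]; last exact: rotation_cvg0_kernel.
split.
- move=> e e0; apply: (filterE (F := nbhs (0 : 'rV[R]_n))) => theta.
  suff -> : U theta 0 = 0 by rewrite subr0 /rnorm normr0.
  by apply/eqP; rewrite -normr_eq0 rnormE rnorm_rotation -rnormE normr0.
- move=> a f g Sf Sg e e0.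
  have a0 : 0 < complex.Re `|a| + 1.
    by rewrite ltr_wpDl // -lecR -ge0_complexE; exact: normr_ge0.
  have e20 : 0 < e / 2 / (complex.Re `|a| + 1) by rewrite !divr_gt0.
  have e20' : 0 < e / 2 by lra.
  apply: filterS2 (Sf _ e20) (Sg _ e20') => theta fU gU.
  have -> : a *: f + g - U theta (a *: f + g) = a *: (f - U theta f) + (g - U theta g).
    by rewrite rotation_linear scalerBr opprD addrACA.
  apply: le_lt_trans (rnormD _ _) _.
  have -> : rnorm (a *: (f - U theta f)) = complex.Re `|a| * rnorm (f - U theta f).
    by apply: (@complexI R); rewrite rmorphM /= -!rnormE normrZ.
  move: fU; rewrite ltr_pdivlMr // mulrDr mulr1 mulrC.
  have := rnorm_ge0 (f - U theta f); lra.
(* Three-epsilon argument: [U theta] is isometric, so [U theta g] approximates [U theta f] uniformly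
   in [theta]. *)
- move=> f /closure_rnorm cf e e0.
  have [|g Sg fg] := cf (e / 3); first by lra.
  have e30 : 0 < e / 3 by lra.
  apply: filterS (Sg _ e30) => theta gU.
  have Ufg : rnorm (U theta g - U theta f) < e / 3.
    by rewrite -rotationB rnorm_rotation rnormBC.
  have := rnorm_dist f g (U theta f); have := rnorm_dist g (U theta g) (U theta f).
  lra.
Qed.

Lemma rotation_continuous f : continuous (fun theta => U theta f).
Proof.
move=> eta; apply/(@cvgrPdist_lt _ _ _ (nbhs eta) (nbhs_filter _)) => e e0.
have re0 : 0 < complex.Re e by rewrite -ltcR -ge0_complexE // ltW.
have cB : (fun theta => theta - eta) @ eta --> (0 : 'rV[R]_n).
  have := @cvgB R 'rV[R]_n _ _ (nbhs_filter _) _ _ eta eta cvg_id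
    (@cvg_cst _ _ _ _ (nbhs_filter _)).
  by rewrite subrr.
have near_eta : \forall theta \near eta, rnorm (f - U (theta - eta) f) < complex.Re e.
  exact: cB (rotation_cvg0 f re0).
apply: filterS near_eta => theta.
by rewrite rnormE rnorm_rotationB (ge0_complexE (ltW e0)) ltcR.
Qed.

End RotationGroup.

End RotationInvariantKernel.

(** * Application to the triangle and its kernel *)

Theorem proposition5p4 (R : realType) (n : nat) (hn : (2 <= n)%N)
    (P : 'I_n -> mpoly n R[i]) (hP : positive_regular P)
    (m : 'I_n -> nat) (hm : forall j, (0 < m j)%N)
    (H : hilbertSpace R) (ev : H -> 'rV[R[i]]_n -> (R[i])^o)
    (hH : holomorphic_RKHS ev (triangle P) (triangle_kernel P m))
    (Mz : 'I_n -> H -> H) (hMz : multiplication_tuple ev (triangle P) Mz) :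
  strongly_circular Mz.
Proof.
have rotP theta z : triangle P z -> triangle P (rotate theta z).
  exact: triangle_rotate.
have Krot := triangle_kernel_rotate P m.
have [U [evU innerU]] := rotation_isometries hH rotP Krot.
have Urot theta : rotates Mz theta (U theta) (U (- theta)).
  split; first exact: (rotation_unitary hH rotP evU innerU).
  by move=> j f; apply: (rotation_mul hH rotP evU) => g z; exact: (hMz j).2.
split; first split.
- split=> [j|j k f]; first exact: (hMz j).1.
  (* The multiplications commute because their values do at each point of the triangle. *)
  by apply: (rkhs_ext hH) => z Dz; rewrite !((hMz _).2 _ _ Dz) mulrCA.
- by move=> theta; exists (U theta), (U (- theta)).
exists U, (fun theta => U (- theta)); split=> //.
- by move=> theta eta h; apply: (rotationD hH rotP evU).
- by move=> theta eta; apply: (rotation_torus hH evU).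
- by move=> h; apply: (rotation_continuous hH rotP evU innerU).
Qed.
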